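(* Let $(S_n)_{n\geq 0}$ be the simple random walk on $\mathbf{Z}$, i.e. $S_n=X_1+\cdots+X_n$ where $(X_k)_{k\geq 1}$ is a sequence of independent random variables with $\mathbf{P}(X_k=1)=\mathbf{P}(X_k=-1)=\tfrac12$. Let $\varepsilon$ be a real number with $0<\varepsilon\leq 1/4$. Then for any odd integer $q\geq 1$ and any integer $a$ coprime with $q$, we have $$\mathbf{P}(S_n \text{ is prime and } S_n\equiv a \pmod q)\ll \frac{1}{\varphi(q)}\,\frac{1}{\log n}$$ for all integers $n\geq 2$ with $q\leq n^{1/4-\varepsilon}$, where the implied constant depends only on $\varepsilon$.
   Context: $\varphi$ denotes Euler's function. The notation $A\ll B$ means $|A|\leq CB$ for some constant $C$ (the implied constant). *)

(* Defs.v *)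
From mathcomp Require Import all_boot all_order all_algebra.
From Stdlib Require Import Reals.
Set Implicit Arguments. Unset Strict Implicit. Unset Printing Implicit Defensive.

(* The steps X_1..X_n of the simple random walk are encoded by x : {ffun 'I_n -> bool},
   X_{i+1} = +1 if x i, -1 otherwise.  Independence + P(X=1)=P(X=-1)=1/2 means the
   joint law of (X_1,...,X_n) is the uniform measure on {+1,-1}^n. *)
Definition step (b : bool) : int := if b then Posz 1 else Negz 0.

Definition srw (n : nat) (x : {ffun 'I_n -> bool}) : int :=
  \big[GRing.add/Posz 0]_(i < n) step (x i).

Definition walk_prob (n : nat) (P : pred int) : R :=
  (INR #|[set x : {ffun 'I_n -> bool} | P (srw x)]| / 2 ^ n)%R.

Definition int_prime (s : int) : bool := @Order.le _ int (Posz 0) s && prime (absz s).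

Definition int_cong (s a : int) (q : nat) : bool := modz s (Posz q) == modz a (Posz q).

(* Main.v *)
(** The law of S_n is unimodal with maximum at most n^(-1/2), so a set having at most M points
    in every window of length about n^(1/2) has probability O(M n^(-1/2)). It remains to see that
    a window of length H = n^(1/2) contains O(H / (phi(q) log n)) primes congruent to a mod q.

    This is an upper bound sieve. For v <= z coprime to q, put
      chi_v(s) = \prod_(p | v) (1 if p does not divide s, 1 - p otherwise).
    These are Ramanujan sums up to sign: their mean along a progression of step q is orthogonal,
    chi_v and chi_w being uncorrelated unless v and w have the same prime divisors. The weight
    W(s) = \sum_v chi_v(s) / v equals L = \sum_v 1 / v when s is a prime > z, whereas the sum of
    W^2 over X terms is at most X L + z^4. Hence the number of primes is at most
    X / L + z^4 + z + 1, and L >= (phi(q) / q) \sum_(v <= z) 1 / v >= (phi(q) / q) log (z + 1).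
    Summing over all v rather than squarefree v replaces Selberg's 1 / phi(v) by 1 / v.
    With z = n^(1/32) and q <= n^(1/4), the error z^4 is O(H / (phi(q) log n)). *)

Require Import Defs.
From mathcomp Require Import all_boot all_order all_algebra.
From mathcomp Require Import ring lra zify Rstruct.
Set Implicit Arguments. Unset Strict Implicit. Unset Printing Implicit Defensive.
Import Order.TTheory GRing.Theory Num.Theory.

(** * Binomial weights and the walk *)

Lemma big_ord_blocks (T : Type) (idx : T) (op : Monoid.law idx) (g : nat -> T) j N :
  \big[op/idx]_(i < j * N) g i = \big[op/idx]_(k < j) \big[op/idx]_(i < N) g (k * N + i).
Proof.
rewrite -(big_mkord xpredT) big_nat_mul big_mkord; apply: eq_bigr => k _.
rewrite mulSn -{1}[k * N]add0n big_addn addnK big_mkord.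
by apply: eq_bigr => i _; rewrite addnC.
Qed.

Lemma sum_ones_le (c : nat -> nat) (A : pred nat) H M : (forall k, c k <= c 0) ->
  \sum_(k < H) A k <= M -> \sum_(k < H | A k) c k <= M * c 0.
Proof.
move=> cle AM; apply: leq_trans (leq_mul AM (leqnn _)); rewrite big_distrl /= big_mkcond /=.
by apply: leq_sum => k _; case: (A k); rewrite ?mul1n.
Qed.

(** Induction on the number of blocks. In a block, [A] picks up at most [M] times the first value of
    [c]; by monotonicity [H] times that value is at most the sum of [c] over the preceding block.
    The first block has no predecessor, whence the extra [H * c 0]. *)
Lemma block_sum (c : nat -> nat) (A : pred nat) H M J :
  (forall i j, i <= j -> c j <= c i) ->
  (forall k, \sum_(i < H) A (k + i) <= M) ->
  H * (\sum_(k < J * H | A k) c k) <= M * (H * c 0 + \sum_(k < J * H) c k).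
Proof.
elim: J c A => [|J IH] c A cmon AM; first by rewrite mul0n big_ord0 muln0.
have {}IH := IH (fun k => c (H + k)) (fun k => A (H + k)).
have {}IH : H * \sum_(k < J * H | A (H + k)) c (H + k)
    <= M * (H * c H + \sum_(k < J * H) c (H + k)).
  have -> : c H = c (H + 0) by rewrite addn0.
  apply: IH => [i j ij|k]; first by apply: cmon; rewrite leq_add2l.
  by under eq_bigr do rewrite addnA.
have cH : H * c H <= \sum_(k < H) c k.
  rewrite -{1}[H]card_ord -sum_nat_const; apply: leq_sum => k _; apply: cmon; exact/ltnW/ltn_ord.
have A0 : \sum_(k < H | A k) c k <= M * c 0.
  by apply: sum_ones_le => [k|]; [exact: cmon | exact: (AM 0)].
rewrite mulSn !big_split_ord /= mulnDr.
have -> : M * (H * c 0 + (\sum_(i < H) c i + \sum_(i < J * H) c (H + i)))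
  = H * (M * c 0) + M * (\sum_(i < H) c i + \sum_(i < J * H) c (H + i)) by ring.
apply: leq_add; first by rewrite leq_mul2l A0 orbT.
by apply: leq_trans IH _; rewrite leq_mul2l leq_add2r cH orbT.
Qed.

(** The ratio of consecutive central coefficients is [2 (2m+1) / (m+1)], so the induction step
    amounts to [(2m+1)(2m+3) <= 4 (m+1)^2]. *)
Lemma bin_central_sqr m : 'C(m.*2, m) ^ 2 * m.*2.+1 <= 16 ^ m.
Proof.
elim: m => [|m IH] //.
have E : m.+1 * 'C(m.+1.*2, m.+1) = 2 * m.*2.+1 * 'C(m.*2, m).
  rewrite doubleS -mul_bin_diag /= -mulnA (mul_bin_down m.*2.+1 m).
  by rewrite mulnA; congr (_ * _); lia.
set x := 'C(_, _) in E *; set y := 'C(_, _) in IH E.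
rewrite -(@leq_pmul2l (m.+1 ^ 2)) //.
have -> : m.+1 ^ 2 * (x ^ 2 * m.+1.*2.+1) = (m.+1 * x) ^ 2 * m.+1.*2.+1 by ring.
rewrite E (expnS 16).
have -> : (2 * m.*2.+1 * y) ^ 2 * m.+1.*2.+1 = (y ^ 2 * m.*2.+1) * (4 * (m.*2.+1 * m.+1.*2.+1)) by ring.
have -> : m.+1 ^ 2 * (16 * 16 ^ m) = 16 ^ m * (4 * (4 * m.+1 ^ 2)) by ring.
apply: leq_mul => //; rewrite leq_mul2l /=; lia.
Qed.

Lemma bin_uphalf_sqr n : 'C(n, uphalf n) ^ 2 * n <= 4 ^ n.
Proof.
have [m [-> | ->]] : exists m, n = m.*2 \/ n = m.*2.+1.
  exists n./2; rewrite -[n in n = _ \/ _]odd_double_half -[n in _ \/ n = _]odd_double_half.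
  by case: (odd n); [right | left].
  rewrite uphalf_double; have -> : 4 ^ m.*2 = 16 ^ m by rewrite -mul2n expnM.
  have := bin_central_sqr m; lia.
have -> : uphalf m.*2.+1 = m.+1 by rewrite uphalfE -doubleS doubleK.
have := bin_central_sqr m.+1; rewrite doubleS.
(* The two middle entries of an odd row are equal, hence each is half the central entry of the next
   row. *)
have -> : 'C(m.*2.+2, m.+1) = 2 * 'C(m.*2.+1, m.+1).
  rewrite binS mul2n -[RHS]addnn; congr (_ + _).
  rewrite -[RHS]bin_sub; last by lia.
  by congr 'C(_, _); lia.
have -> : 4 ^ m.*2.+1 = 4 * 16 ^ m by rewrite expnS -mul2n expnM.
rewrite (expnS 16); lia.
Qed.

Lemma bin_decr n i j : n <= i.*2.+1 -> i <= j -> 'C(n, j) <= 'C(n, i).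
Proof.
move=> ni; elim: j => [|j IH]; first by rewrite leqn0 => /eqP->.
rewrite leq_eqVlt => /orP[/eqP->//|]; rewrite ltnS => ij.
apply: leq_trans (IH ij); rewrite -(@leq_pmul2l j.+1) // mul_bin_left.
by rewrite leq_mul2r; apply/orP; right; lia.
Qed.

Lemma srwE n (x : {ffun 'I_n -> bool}) :
  srw x = (Posz (#|[set i | x i]|.*2) - Posz n)%R.
Proof.
have E : (\sum_(i < n) (x i)%:R)%R = Posz #|[set i | x i]|.
  rewrite cardsE -sum1_card [in RHS]big_mkcond /= -[RHS]natz GRing.natr_sum.
  by apply: eq_bigr => i _; rewrite -topredE /=; case: (x i).
rewrite /srw; transitivity (\sum_(i < n) ((x i)%:R *+ 2 - 1 : int))%R.
  by apply: (@eq_bigr int (Posz 0) _%R) => i _; rewrite /step; case: (x i).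
rewrite GRing.sumrB GRing.sumr_const card_ord GRing.sumrMnl E natz.
by rewrite -addnn PoszD GRing.mulr2n.
Qed.

(** Walks are identified with their sets of up steps, then grouped by the size [k] of this set; such
    a walk ends at [2k - n]. *)
Lemma card_srw n (P : pred int) :
  #|[set x : {ffun 'I_n -> bool} | P (srw x)]|
  = \sum_(k < n.+1 | P (Posz k.*2 - Posz n)%R) 'C(n, k).
Proof.
have bij : bijective (fun A : {set 'I_n} => [ffun i => i \in A]).
  exists (fun x : {ffun 'I_n -> bool} => [set i | x i]) => [A|x].
    by apply/setP => i; rewrite inE ffunE.
  by apply/ffunP => i; rewrite ffunE inE.
have cardA (A : {set 'I_n}) : #|A| < n.+1 by have := max_card (mem A); rewrite card_ord ltnS.
rewrite -sum1dep_card (reindex _ (onW_bij _ bij)) /=.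
rewrite (eq_bigl (fun A : {set 'I_n} => P (Posz #|A|.*2 - Posz n)%R)); last first.
  move=> A; rewrite srwE; congr (P (Posz _.*2 - _)%R).
  by apply: eq_card => i; rewrite inE ffunE.
(* Since [#|A| <= n], [inord] never returns its default value here. *)
rewrite (partition_big (fun A : {set 'I_n} => inord #|A| : 'I_n.+1)
  (fun k : 'I_n.+1 => P (Posz k.*2 - Posz n)%R)) /=; last by move=> A; rewrite inordK.
apply: eq_bigr => k Pk; rewrite -[n in 'C(n, _)]card_ord -card_draws -sum1dep_card.
apply: eq_bigl => A; rewrite -val_eqE /= inordK //.
by case: eqP => [->|]; rewrite ?Pk ?andbF.
Qed.

(* Only k >= n/2 contributes; there the weights decrease, so a set that has at most M points in
   every window of length H has weight at most M/H times the total, up to the central term. *)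
Lemma bin_sum_le n H M (A : pred nat) : 0 < H -> H ^ 2 <= n ->
  (forall k, \sum_(i < H) A ((k + i).*2 + odd n) <= M) ->
  H * (\sum_(k < n.+1 | (n <= k.*2) && A (k.*2 - n)) 'C(n, k)) <= M * 2 ^ n.+1.
Proof.
move=> H0 Hn AM.
(* [u] is the least [k] with [n <= 2k], and [u + k] up steps lead to the position [2k + odd n]. *)
set u := uphalf n.
have u2 : u.*2 = n + odd n by rewrite /u uphalf_half; have := odd_double_half n; lia.
(* The central term costs no more than the total mass because [H] is at most the square root of [n];
   together they give the exponent [n.+1]. *)
have cH : H * 'C(n, u) <= 2 ^ n.
  rewrite -leq_sqr; have -> : (2 ^ n) ^ 2 = 4 ^ n by rewrite -expnM mulnC expnM.
  apply: leq_trans (bin_uphalf_sqr n).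
  by rewrite expnMn mulnC leq_mul2l Hn orbT.
have tot J : \sum_(k < J) 'C(n, u + k) <= 2 ^ n.
  have -> : 2 ^ n = \sum_(0 <= k < n.+1) 'C(n, k).
    rewrite -[2]/(1 + 1) expnDn big_mkord.
    by apply: eq_bigr => k _; rewrite !exp1n !muln1.
  apply: (@leq_trans (\sum_(0 <= k < u + J + n.+1) 'C(n, k))).
    rewrite (@big_cat_nat _ _ _ u) ?leq_addr //= -?addnA ?leq_addr //.
    rewrite (@big_cat_nat _ _ _ (u + J) u) ?leq_addr ?addnA ?leq_addr //=.
    have -> : \sum_(k < J) 'C(n, u + k) = \sum_(u <= k < u + J) 'C(n, k).
      rewrite -[X in index_iota X _]add0n big_addn addKn big_mkord.
      by apply: eq_bigr => k _; rewrite addnC.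
    by lia.
  rewrite (@big_cat_nat _ _ _ n.+1) ?leq_addl //= [X in _ + X]big_nat [X in _ + X]big1 ?addn0 //.
  by move=> k /andP[k1 _]; exact: bin_small.
(* [n.+1] blocks of length [H > 0] certainly cover all indices up to [n]. *)
have := @block_sum (fun k => 'C(n, u + k)) (fun k => A (k.*2 + odd n)) H M n.+1 _ _.
rewrite addn0 => /(_ _ AM) B.
have {}B : H * \sum_(k < n.+1 * H | A (k.*2 + odd n)) 'C(n, u + k) <= M * 2 ^ n.+1.
  apply: (leq_trans (B _)) => [i j ij|]; first by apply: bin_decr; [move: u2; lia | rewrite leq_add2l].
  by rewrite leq_mul2l expnS mul2n -addnn leq_add ?orbT.
apply: leq_trans B; rewrite leq_mul2l; apply/orP; right.
rewrite -(big_mkord (fun k => (n <= k.*2) && A (k.*2 - n)) (fun k => 'C(n, k))).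
have un : u <= n.+1 by move: u2; lia.
rewrite (@big_cat_nat _ _ _ u) //= [X in X + _]big_nat_cond big_pred0 ?add0n; last first.
  by move=> k; apply/negbTE; move: u2; lia.
rewrite -{1}[u]add0n big_addn big_mkord.
rewrite (big_ord_widen_cond (n.+1 * H)
  (fun i => (n <= (i + u).*2) && A ((i + u).*2 - n)) (fun i => 'C(n, i + u))); last first.
  by apply: leq_trans (leq_subr _ _) _; rewrite leq_pmulr.
rewrite [X in X <= _]big_mkcond [X in _ <= X]big_mkcond /=; apply: leq_sum => k _.
case: ifP => // /andP[/andP[_ Ak] _].
have -> : k.*2 + odd n = (k + u).*2 - n by move: u2; rewrite doubleD; lia.
by rewrite Ak addnC.
Qed.

(** * Sieve bound for primes in progressions *)

Section Sieve.
Local Open Scope ring_scope.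
Variable F : realFieldType.
Implicit Types (g h : nat -> F) (p q s v w z : nat).

(** * Sums of periodic functions along progressions *)

Definition periodic p g := forall i, g (i %% p)%N = g i.

Lemma periodicM p g i j : periodic p g -> g (j * p + i)%N = g i.
Proof. by move=> gP; rewrite -gP modnMDl gP. Qed.

Lemma periodic_affine p g b c : periodic p g -> periodic p (fun i => g (b + c * i)%N).
Proof. by move=> gP i; rewrite -gP -modnDmr modnMmr modnDmr gP. Qed.

Lemma periodic_dvd p N g : (p %| N)%N -> periodic p g -> periodic N g.
Proof. by move=> pN gP i; rewrite -gP modn_dvdm // gP. Qed.

(** For [c] coprime to [p], the map [i -> b + c * i] permutes the residues modulo [p]. *)
Lemma sum_periodic_affine p g b c : (0 < p)%N -> coprime c p -> periodic p g ->
  \sum_(i < p) g (b + c * i)%N = \sum_(i < p) g i.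
Proof.
move=> p0 cp gP.
pose f (i : 'I_p) := Ordinal (ltn_pmod (b + c * i) p0).
have finj : injective f.
  move=> i j /(congr1 val) /= /eqP; rewrite eqn_modDl.
  wlog ij : i j / (i <= j)%N.
    by move=> W E; case/orP: (leq_total i j) => H; [exact: W | symmetry; apply: W => //; rewrite eq_sym].
  rewrite eq_sym eqn_mod_dvd ?leq_mul2l ?ij ?orbT // -mulnBr Gauss_dvdr 1?coprime_sym // => d.
  apply/val_inj/eqP => /=; rewrite eqn_leq ij /= -subn_eq0.
  by case: posnP => // H; move: (dvdn_leq H d); have := ltn_ord j; lia.
rewrite [RHS](reindex_inj finj); apply: eq_bigr => i _ /=.
by rewrite gP.
Qed.

(** Chinese remainder theorem: cut the range into [p] blocks of length [N]. At a fixed place [i] of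
    the blocks [h] is constant, while [g] runs through all residues modulo [p]. *)
Lemma sum_periodicM p N g h : (0 < p)%N -> coprime N p -> periodic p g -> periodic N h ->
  \sum_(i < p * N) g i * h i = (\sum_(i < p) g i) * (\sum_(i < N) h i).
Proof.
move=> p0 cNp gP hP; rewrite (big_ord_blocks _ (fun i => g i * h i)) exchange_big /= mulr_sumr.
apply: eq_bigr => i _; under eq_bigr do rewrite (periodicM _ _ hP).
rewrite -mulr_suml -(sum_periodic_affine i p0 cNp gP).
by congr (_ * _); apply: eq_bigr => k _; rewrite addnC mulnC.
Qed.

Lemma periodic_prod (ps : seq nat) (G : nat -> nat -> F) :
  (forall p, p \in ps -> periodic p (G p)) ->
  periodic (\prod_(p <- ps) p) (fun i => \prod_(p <- ps) G p i).
Proof.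
move=> GP i; apply: eq_big_seq => p pin.
by apply: (@periodic_dvd p _ (G p) _ (GP p pin)); rewrite (big_rem p) //= dvdn_mulr.
Qed.

Lemma sum_prod_periodic (ps : seq nat) (G : nat -> nat -> F) :
  uniq ps -> all prime ps -> (forall p, p \in ps -> periodic p (G p)) ->
  \sum_(i < \prod_(p <- ps) p) \prod_(p <- ps) G p i = \prod_(p <- ps) \sum_(i < p) G p i.
Proof.
elim: ps => [|p ps IH] /=; first by rewrite !big_nil big_ord1 big_nil.
case/andP=> pps ups /andP[pp aps] GP.
have GP' r : r \in ps -> periodic r (G r) by move=> rin; apply: (GP r); rewrite inE rin orbT.
rewrite !big_cons -IH //; under eq_bigr do rewrite big_cons.
apply: (@sum_periodicM p _ (G p) (fun i => \prod_(r <- ps) G r i)).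
- exact: prime_gt0.
- rewrite big_seq; elim/big_rec: _ => [|r x rin cx]; first exact: coprime1n.
  rewrite coprimeMl cx andbT (prime_coprime _ (allP aps r rin)) (dvdn_prime2 (allP aps r rin) pp).
  by apply: contraNneq pps => <-.
- exact: (GP p (mem_head _ _)).
- exact: periodic_prod.
Qed.

(** Complete periods have mean exactly [mu]; the incomplete last one has fewer than [N] terms, each
    at most [B]. *)
Lemma sum_periodic_le N g (mu B : F) X : (0 < N)%N -> periodic N g ->
  (forall i, g i <= B) -> 0 <= B -> 0 <= mu -> \sum_(i < N) g i = N%:R * mu ->
  \sum_(i < X) g i <= X%:R * mu + N%:R * B.
Proof.
move=> N0 gP gB B0 mu0 gmu.
rewrite -(big_mkord xpredT) (@big_cat_nat _ _ _ (X %/ N * N)) //=; last exact: leq_trunc_div.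
apply: lerD.
  rewrite big_mkord big_ord_blocks.
  under eq_bigr do under eq_bigr do rewrite (periodicM _ _ gP).
  rewrite gmu sumr_const card_ord -[X in X <= _]mulr_natl mulrA -natrM ler_wpM2r //.
  by rewrite ler_nat leq_trunc_div.
apply: (@le_trans _ _ (\sum_(X %/ N * N <= i < X) B)); first by apply: ler_sum.
rewrite sumr_const_nat -[X in X <= _]mulr_natl ler_wpM2r // ler_nat.
by rewrite {1}(divn_eq X N) addnC addnK ltnW // ltn_pmod.
Qed.

(** * Sieve characters and their orthogonality *)

Definition sieve_factor p s : F := if (p %| s)%N then - p.-1%:R else 1.
(** With [r = rad v], this is the Ramanujan sum [c_r(s)] times the Moebius function of [r]. *)
Definition sieve_char v s : F := \prod_(p <- primes v) sieve_factor p s.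

Lemma sieve_factor_periodic p : periodic p (sieve_factor p).
Proof. by move=> i; rewrite /sieve_factor /dvdn modn_mod. Qed.

Lemma sum_dvd_or p (x y : F) : (0 < p)%N ->
  \sum_(i < p) (if (p %| i)%N then x else y) = x + p.-1%:R * y.
Proof.
case: p => // p _; rewrite big_ord_recl dvdn0 /=; congr (_ + _).
rewrite (eq_bigr (fun=> y)) ?sumr_const ?card_ord ?mulr_natl // => i _.
by rewrite [bump 0 i]add1n gtnNdvd // ltnS.
Qed.

Lemma sum_sieve_factor p : (0 < p)%N -> \sum_(i < p) sieve_factor p i = 0.
Proof. by move=> p0; rewrite sum_dvd_or // mulr1 addNr. Qed.

Lemma sum_sieve_factor_sqr p : (0 < p)%N ->
  \sum_(i < p) sieve_factor p i ^+ 2 = p%:R * p.-1%:R.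
Proof.
move=> p0; under eq_bigr do rewrite /sieve_factor (fun_if (fun x => x ^+ 2)) expr1n.
rewrite sum_dvd_or //; case: p p0 => // p _ /=.
by rewrite -[p.+1]addn1 natrD; ring.
Qed.

Lemma sieve_factor_abs p s : prime p -> `|sieve_factor p s| <= p.-1%:R.
Proof.
move=> pp; rewrite /sieve_factor; case: ifP => _; first by rewrite normrN ger0_norm ?ler0n.
by rewrite normr1 ler1n; case: p pp => [|[]].
Qed.

Definition rad v := (\prod_(p <- primes v) p)%N.
(** Euler's function of [rad v], which turns out to be the mean square of [sieve_char v]. *)
Definition rad_phi v : F := \prod_(p <- primes v) p.-1%:R.

Lemma rad_leq v : (0 < v)%N -> (rad v <= v)%N.
Proof.
move=> v0; rewrite {2}(prod_prime_decomp v0) prime_decompE big_map /= /rad.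
rewrite !big_seq; apply: leq_prod => p pv.
by rewrite -{1}[p]expn1 leq_exp2l ?logn_gt0 // prime_gt1 //; move: pv; rewrite mem_primes => /andP[].
Qed.

Lemma rad_gt0 v : (0 < rad v)%N.
Proof.
rewrite /rad big_seq; elim/big_rec: _ => // p x pv x0; rewrite muln_gt0 x0 andbT.
by move: pv; rewrite mem_primes => /andP[/prime_gt0].
Qed.

Lemma rad_phi_ge0 v : 0 <= rad_phi v.
Proof. by apply: prodr_ge0 => p _; exact: ler0n. Qed.

Lemma rad_phi_le v : (0 < v)%N -> rad_phi v <= v%:R.
Proof.
move=> v0; apply: (@le_trans _ _ (rad v)%:R); last by rewrite ler_nat rad_leq.
by rewrite /rad_phi /rad natr_prod; apply: ler_prod => p _; rewrite ler0n ler_nat leq_pred.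
Qed.

Lemma sieve_char_abs v s : (0 < v)%N -> `|sieve_char v s| <= v%:R.
Proof.
move=> v0; apply: le_trans (rad_phi_le v0).
rewrite /sieve_char normr_prod /rad_phi !big_seq; apply: ler_prod => p.
by rewrite mem_primes => /andP[pp _]; rewrite normr_ge0 sieve_factor_abs.
Qed.

(** Indexing by the primes of a common multiple [N] allows two characters to be multiplied prime by
    prime. *)
Lemma sieve_charE v N s : (0 < v)%N -> (0 < N)%N -> (v %| N)%N ->
  sieve_char v s = \prod_(p <- primes N) (if p \in primes v then sieve_factor p s else 1).
Proof.
move=> v0 N0 vN; rewrite -big_mkcond -big_filter; apply: perm_big; apply: uniq_perm.
- exact: primes_uniq.
- exact/filter_uniq/primes_uniq.
- move=> p; rewrite mem_filter !mem_primes N0 v0 /=.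
  by case: (prime p) => //=; case pv: (p %| v)%N => //=; rewrite (dvdn_trans pv vN).
Qed.

(** The sum over a full period factors over the primes of [v * w], and coprimality to [q] makes the
    progression meet every residue modulo each of them. A prime dividing only one of [v], [w] gives
    the factor 0; a common prime [p] gives [p (p - 1)]. *)
Lemma sum_sieve_char v w q b : (0 < v)%N -> (0 < w)%N -> coprime v q -> coprime w q ->
  \sum_(m < rad (v * w)) sieve_char v (b + q * m) * sieve_char w (b + q * m)
  = (rad (v * w))%:R * (if primes v == primes w then rad_phi v else 0).
Proof.
move=> v0 w0 cv cw.
have vw0 : (0 < v * w)%N by rewrite muln_gt0 v0.
pose g p s := (if p \in primes v then sieve_factor p s else 1)
  * (if p \in primes w then sieve_factor p s else 1).
have gP p : periodic p (g p) by move=> i; rewrite /g !sieve_factor_periodic.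
under eq_bigr => m _ do
  rewrite (@sieve_charE v (v * w)) ?dvdn_mulr //
    (@sieve_charE w (v * w)) ?dvdn_mull // -big_split /= -/(g _ _).
rewrite (@sum_prod_periodic _ (fun p i => g p (b + q * i)%N)) ?primes_uniq //; first last.
- by move=> p _; apply: periodic_affine.
- by apply/allP => p; rewrite mem_primes => /andP[].
have cpr p : p \in primes (v * w) -> coprime q p.
  rewrite mem_primes vw0 => /and3P[pp _]; rewrite Euclid_dvdM // => /orP[] d.
    by rewrite coprime_sym (coprime_dvdl d).
  by rewrite coprime_sym (coprime_dvdl d).
have p0 p : p \in primes (v * w) -> (0 < p)%N by rewrite mem_primes => /andP[/prime_gt0].
have -> : \prod_(p <- primes (v * w)) \sum_(i < p) g p (b + q * i)%N
  = \prod_(p <- primes (v * w)) \sum_(i < p) g p i.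
  by apply: eq_big_seq => p pin; apply: sum_periodic_affine; [exact: p0 | exact: cpr | exact: gP].
case: eqP => [E|NE].
  have Ep : primes (v * w) = primes v.
    by apply/eq_primes => p; rewrite primesM // E orbb.
  rewrite /rad /rad_phi Ep natr_prod -big_split /=; apply: eq_big_seq => p pv.
  rewrite -sum_sieve_factor_sqr ?p0 ?Ep //; apply: eq_bigr => i _.
  by rewrite /g -E pv expr2.
rewrite mulr0; apply/eqP; rewrite prodf_seq_eq0.
have [p pin H] : exists2 p, p \in primes (v * w) & (p \in primes v) != (p \in primes w).
  apply/hasP; apply: contra_notT NE => /hasPn A; apply/eq_primes => p.
  case pvw: (p \in primes (v * w)); first by move/eqP: (negPn (A p pvw)).
  by move: pvw; rewrite primesM // => /norP[/negbTE-> /negbTE->].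
apply/hasP; exists p => //=; apply/eqP.
rewrite -[RHS](sum_sieve_factor (p0 _ pin)); apply: eq_bigr => i _.
by rewrite /g; move: H; case: (p \in primes v); case: (p \in primes w) => // _; rewrite ?mulr1 ?mul1r.
Qed.

(** * Sums of reciprocals with prescribed or excluded prime divisors *)

Lemma primesM_cons p ps u : prime p -> (0 < u)%N -> primes (p * u) = p :: ps ->
  primes u = p :: ps \/ primes u = ps.
Proof.
move=> pp u0 E.
have M r : (r \in p :: ps) = (r == p) || (r \in primes u).
  by rewrite -E (primesM _ (prime_gt0 pp) u0) primes_prime // inE.
have := sorted_primes (p * u); have := primes_uniq (p * u); rewrite E => /= /andP[pps _] srt.
case pu: (p \in primes u); [left | right].
  by rewrite -E; apply/eq_primes => r; rewrite E M; case: eqP => [->|].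
apply: (irr_sorted_eq ltn_trans ltnn (sorted_primes u) (path_sorted srt)) => r.
have := M r; rewrite inE; case: eqP => [->|] //= _.
by rewrite pu (negbTE pps).
Qed.

(** Substitute [v = p * u]; letting [u] run up to [z] instead of [z / p] only adds nonnegative
    terms. *)
Lemma sum_inv_dvd p z (P : pred nat) : (0 < p)%N ->
  \sum_(v < z.+1 | (p %| v)%N && P v) v%:R^-1
  <= p%:R^-1 * \sum_(u < z.+1 | P (p * u)%N) (u%:R^-1 : F).
Proof.
move=> p0; rewrite mulr_sumr [X in _ <= X]big_mkcond /=.
(* Extended by zero to [z.+1 * p] terms, the sum splits into blocks of length [p], each with a
   single multiple of [p], its first element. *)
pose g v : F := if (p %| v)%N && P v then v%:R^-1 else 0.
apply: (@le_trans _ _ (\sum_(v < z.+1 * p) g v)).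
  rewrite big_mkcond /= (big_ord_widen _ g (leq_pmulr z.+1 p0)) big_mkcond /=.
  by apply: ler_sum => v _; case: ifP => // _; rewrite /g; case: ifP => // _; rewrite invr_ge0 ler0n.
rewrite (big_ord_blocks _ g); apply: ler_sum => k _; case: p p0 @g => // p _ g.
rewrite big_ord_recl big1 => [|i _]; last first.
  by rewrite /g dvdn_addr ?dvdn_mull //= [bump 0 i]add1n gtnNdvd // ltnS.
by rewrite /g /= addr0 addn0 dvdn_mull // mulnC natrM invfM.
Qed.

(* A number with prime divisors [p :: ps] is [p * u] where [u] has prime divisors [p :: ps] or [ps]. *)
Lemma sum_inv_primes z (ps : seq nat) : all prime ps ->
  (\prod_(p <- ps) p.-1%:R) * \sum_(w < z.+1 | (0 < w)%N && (primes w == ps)) (w%:R^-1 : F) <= 1.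
Proof.
elim: ps => [_|p ps IH /= /andP[pp aps]].
  rewrite big_nil mul1r; case: z => [|z]; first by rewrite big_mkcond big_ord1.
  rewrite big_mkcond 2!big_ord_recl /= add0r invr1 big1 ?addr0 // => i _.
  by rewrite primes_eq0.
rewrite big_cons; set W := \sum_(w < _ | _) _; move: {IH}(IH aps); set W' := \sum_(w < _ | _) _ => IH.
have p0 := prime_gt0 pp.
have W_le : W <= p%:R^-1 * (W + W').
  have EW : W = \sum_(w < z.+1 | (p %| w)%N && ((0 < w)%N && (primes w == p :: ps))) w%:R^-1.
    apply: eq_bigl => w; case: eqP => [E|]; rewrite ?andbF // andbT.
    by have := mem_head p ps; rewrite -E mem_primes => /and3P[_ -> ->].
  rewrite [X in X <= _]EW.
  apply: le_trans (sum_inv_dvd z (fun w => (0 < w)%N && (primes w == p :: ps)) p0) _.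
  rewrite ler_wpM2l ?invr_ge0 ?ler0n // /W /W' big_mkcond /= [X in _ <= X + _]big_mkcond /=.
  rewrite [X in _ <= _ + X]big_mkcond /= -big_split /=; apply: ler_sum => u _.
  have i0 : 0 <= (u%:R^-1 : F) by rewrite invr_ge0 ler0n.
  case: ifP => [/andP[pu /eqP E]|_]; last by apply: addr_ge0; case: ifP.
  have u0 : (0 < u)%N by move: pu; rewrite muln_gt0 => /andP[].
  rewrite u0 /=; case: (primesM_cons pp u0 E) => ->; rewrite eqxx ?lerDl ?lerDr //; by case: ifP.
(* [W] stands on both sides of [p * W <= W + W']; cancelling it turns [p] into [p - 1]. *)
have {}W_le : p.-1%:R * W <= W'.
  have pE : (p%:R : F) = p.-1%:R + 1 by rewrite -{1}(prednK p0) -addn1 natrD.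
  have pp0 : 0 < (p%:R : F) by rewrite ltr0n.
  move: W_le; rewrite mulrC ler_pdivlMr // pE; lra.
apply: le_trans IH; rewrite mulrC mulrA [W * _]mulrC mulrC.
by rewrite ler_wpM2l // prodr_ge0.
Qed.

(* Passing from [ps] to [p :: ps] discards the multiples of [p], a proportion at most [1 / p]. *)
Lemma sum_inv_coprime_seq z (ps : seq nat) : all prime ps ->
  (\prod_(p <- ps) (p.-1%:R / p%:R)) * \sum_(v < z.+1 | (0 < v)%N) (v%:R^-1 : F)
  <= \sum_(v < z.+1 | (0 < v)%N && all (fun p => ~~ (p %| v)%N) ps) v%:R^-1.
Proof.
elim: ps => [_|p ps IH /= /andP[pp aps]].
  by rewrite big_nil mul1r; under [X in _ <= X]eq_bigl do rewrite andbT.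
have p0 := prime_gt0 pp.
have pE : (p.-1%:R : F) = p%:R - 1 by rewrite -{2}(prednK p0) -addn1 natrD; ring.
have pp0 : 0 < (p%:R : F) by rewrite ltr0n.
rewrite big_cons -mulrA.
apply: le_trans (ler_wpM2l _ (IH aps)) _; first by rewrite divr_ge0 ?ler0n.
rewrite pE mulrBl divff ?lt0r_neq0 // mulrBl !mul1r lerBlDr.
rewrite [X in X <= _](bigID (fun v : 'I_z.+1 => (p %| v)%N)) /= addrC; apply: lerD.
  by rewrite le_eqVlt; apply/orP; left; apply/eqP/eq_bigl => v; rewrite -andbA; congr andb; rewrite andbC.
under eq_bigl do rewrite andbC.
apply: le_trans (sum_inv_dvd z (fun v => (0 < v)%N && all (fun p => ~~ (p %| v)%N) ps) p0) _.
rewrite ler_wpM2l ?invr_ge0 ?ler0n // big_mkcond [X in _ <= X]big_mkcond /=.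
apply: ler_sum => u _; case: ifP => [/andP[pu /allP A]|_]; last by case: ifP; rewrite ?invr_ge0 ?ler0n.
case: ifP => // /negP[]; apply/andP; split; first by move: pu; rewrite muln_gt0 => /andP[].
by apply/allP => r /A; apply: contra => d; apply: dvdn_mull.
Qed.

Lemma coprime_all_primes v q : (0 < q)%N -> coprime v q = all (fun p => ~~ (p %| v)%N) (primes q).
Proof.
move=> q0; apply/idP/allP => [cvq p|A].
  rewrite mem_primes => /and3P[pp _ pq]; apply/negP => pv.
  have : (p %| gcdn v q)%N by rewrite dvdn_gcd pv.
  by rewrite (eqP cvq) dvdn1 => /eqP E; rewrite E in pp.
rewrite /coprime; apply: contraT => ne.
have g0 : (0 < gcdn v q)%N by rewrite gcdn_gt0 q0 orbT.
have pp : prime (pdiv (gcdn v q)) by apply: pdiv_prime; lia.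
have := pdiv_dvd (gcdn v q); rewrite dvdn_gcd => /andP[pv pq].
by have := A (pdiv (gcdn v q)); rewrite mem_primes pp q0 pq pv => /(_ isT).
Qed.

Lemma totient_prod q : (0 < q)%N ->
  (totient q)%:R / q%:R = \prod_(p <- primes q) (p.-1%:R / p%:R) :> F.
Proof.
move=> q0; rewrite totientE //.
have qE : q = (\prod_(p <- primes q) p ^ logn p q)%N.
  by rewrite {1}(prod_prime_decomp q0) prime_decompE big_map.
rewrite [X in _ / X%:R]qE !natr_prod -prodf_div; apply: eq_big_seq => p pq.
have p0 : (p%:R : F) != 0 by move: pq; rewrite mem_primes pnatr_eq0 => /andP[/prime_gt0]; rewrite lt0n.
have l0 : (0 < logn p q)%N by rewrite logn_gt0.
rewrite -{2}(prednK l0) expnS !natrM invfM; field.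
by rewrite p0 natrX expf_neq0.
Qed.

(** * The sieve weight and the sieve inequality *)

Definition harm z : F := \sum_(v < z.+1 | (0 < v)%N) v%:R^-1.
Definition sieve_mass z q : F := \sum_(v < z.+1 | (0 < v)%N && coprime v q) v%:R^-1.

Lemma sieve_mass_ge z q : (0 < q)%N -> (totient q)%:R / q%:R * harm z <= sieve_mass z q.
Proof.
move=> q0; rewrite totient_prod // /sieve_mass; under [X in _ <= X]eq_bigl do rewrite coprime_all_primes //.
by apply: sum_inv_coprime_seq; apply/allP => p; rewrite mem_primes => /andP[].
Qed.

Lemma sieve_mass_ge1 z q : (0 < z)%N -> 1 <= sieve_mass z q.
Proof.
case: z => // z _; rewrite /sieve_mass big_mkcond 2!big_ord_recl /= coprime1n add0r invr1 lerDl.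
by apply: sumr_ge0 => i _; case: ifP; rewrite ?invr_ge0 ?ler0n.
Qed.

Definition sieve_weight z q s : F :=
  \sum_(v < z.+1 | (0 < v)%N && coprime v q) v%:R^-1 * sieve_char v s.

Lemma sieve_weight_prime z q s : prime s -> (z < s)%N -> sieve_weight z q s = sieve_mass z q.
Proof.
move=> ps zs; apply: eq_bigr => v /andP[v0 _].
rewrite /sieve_char big_seq big1 ?mulr1 // => p.
rewrite mem_primes => /and3P[pp _ pv]; rewrite /sieve_factor dvdn_prime2 //.
case: eqP => // E; have := dvdn_leq v0 pv; have := ltn_ord v; lia.
Qed.

(** Expand the square. For fixed [v], the [w] with the same prime divisors contribute at most
    [X / v], because [sum_inv_primes] compensates [rad_phi v]; summing over [v] gives the main term.
    Each of the at most [z^2] pairs has an error of at most [z^2] from the incomplete period. *)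
Lemma sum_sieve_weight_sqr z q b X :
  \sum_(m < X) sieve_weight z q (b + q * m) ^+ 2 <= X%:R * sieve_mass z q + z%:R ^+ 4.
Proof.
pose ok (v : 'I_z.+1) := (0 < v)%N && coprime v q.
(* The index 0 is excluded by [ok], so there are at most [z] terms rather than [z.+1]. *)
have cnt (c : F) : 0 <= c -> \sum_(v < z.+1 | ok v) c <= z%:R * c.
  move=> c0; rewrite big_mkcond big_ord_recl /= add0r mulr_natl -[X in _ *+ X]card_ord -sumr_const.
  by apply: ler_sum => v _; case: ifP.
have -> : \sum_(m < X) sieve_weight z q (b + q * m) ^+ 2
  = \sum_(v < z.+1 | ok v) \sum_(w < z.+1 | ok w) v%:R^-1 * w%:R^-1 *
     \sum_(m < X) sieve_char v (b + q * m) * sieve_char w (b + q * m).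
  under eq_bigr do rewrite expr2 /sieve_weight big_distrlr /=.
  rewrite exchange_big /=; apply: eq_bigr => v _.
  rewrite exchange_big /=; apply: eq_bigr => w _.
  by rewrite mulr_sumr; apply: eq_bigr => m _; ring.
have inner (v w : 'I_z.+1) : ok v -> ok w -> v%:R^-1 * w%:R^-1 *
     (\sum_(m < X) sieve_char v (b + q * m) * sieve_char w (b + q * m)) <=
   X%:R * v%:R^-1 * (if primes w == primes v then rad_phi v * w%:R^-1 else 0) + z%:R ^+ 2.
  move=> /andP[v0 cv] /andP[w0 cw].
  have v0' : 0 < (v%:R : F) by rewrite ltr0n.
  have w0' : 0 < (w%:R : F) by rewrite ltr0n.
  have vz : (v%:R : F) <= z%:R by rewrite ler_nat -ltnS.
  have wz : (w%:R : F) <= z%:R by rewrite ler_nat -ltnS.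
  pose mu : F := if primes v == primes w then rad_phi v else 0.
  have H : \sum_(m < X) sieve_char v (b + q * m) * sieve_char w (b + q * m)
    <= X%:R * mu + (rad (v * w))%:R * (v%:R * w%:R).
    apply: (@sum_periodic_le (rad (v * w)) (fun m => sieve_char v (b + q * m) * sieve_char w (b + q * m))).
    - exact: rad_gt0.
    - have P u : (0 < u)%N -> (u %| v * w)%N -> periodic (rad (v * w)) (sieve_char u).
        move=> u0 du i; rewrite !(@sieve_charE u (v * w)) ?muln_gt0 ?v0 //.
        by apply: (periodic_prod (G := fun p s => if p \in primes u then sieve_factor p s else 1)) => p _ j;
          rewrite sieve_factor_periodic.
      move=> i; congr (_ * _).
        exact: (periodic_affine b q (P v v0 (dvdn_mulr _ (dvdnn v))) i).
      exact: (periodic_affine b q (P w w0 (dvdn_mull _ (dvdnn w))) i).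
    - move=> i; apply: le_trans (ler_norm _) _; rewrite normrM.
      by rewrite ler_pM ?sieve_char_abs.
    - by rewrite mulr_ge0 ?ler0n.
    - by rewrite /mu; case: ifP => // _; exact: rad_phi_ge0.
    - exact: sum_sieve_char.
  have i0 : 0 <= (v%:R^-1 * w%:R^-1 : F) by rewrite mulr_ge0 ?invr_ge0 ?ler0n.
  apply: le_trans (ler_wpM2l i0 H) _; rewrite mulrDr; apply: lerD.
    rewrite /mu [primes w == _]eq_sym; case: ifP => _; last by rewrite !mulr0.
    by rewrite le_eqVlt; apply/orP; left; apply/eqP; ring.
  (* The weights cancel the bound [v * w] on the product of the characters, leaving only the
     period. *)
  have -> : v%:R^-1 * w%:R^-1 * ((rad (v * w))%:R * (v%:R * w%:R)) = (rad (v * w))%:R :> F.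
    by field; rewrite !lt0r_neq0.
  rewrite -natrX ler_nat; apply: leq_trans (rad_leq _) _; first by rewrite muln_gt0 v0.
  by rewrite leq_mul // -ltnS.
apply: (@le_trans _ _ (\sum_(v < z.+1 | ok v) (X%:R * v%:R^-1 + z%:R ^+ 3))).
  apply: ler_sum => v okv; have /andP[v0 cv] := okv.
  apply: (@le_trans _ _ (\sum_(w < z.+1 | ok w) (X%:R * v%:R^-1 *
    (if primes w == primes v then rad_phi v * w%:R^-1 else 0) + z%:R ^+ 2))).
    by apply: ler_sum => w okw; exact: inner.
  rewrite big_split /=; apply: lerD.
    rewrite -mulr_sumr ler_piMr ?mulr_ge0 ?invr_ge0 ?ler0n //.
    have A : all prime (primes v) by apply/allP => p; rewrite mem_primes => /andP[].
    apply: le_trans (sum_inv_primes z A); rewrite -/(rad_phi v) mulr_sumr.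
    rewrite big_mkcond [X in _ <= X]big_mkcond /=; apply: ler_sum => w _.
    rewrite /ok; case: (0 < w)%N => //=; case: ifP => _; case: ifP => // _.
    by rewrite mulr_ge0 ?rad_phi_ge0 ?invr_ge0 ?ler0n.
  by rewrite [z%:R ^+ 3]exprS; apply: cnt; rewrite exprn_ge0 ?ler0n.
rewrite big_split /= -mulr_sumr; apply: lerD => //.
by rewrite [z%:R ^+ 4]exprS; apply: cnt; rewrite exprn_ge0 ?ler0n.
Qed.

Lemma sum_ltn k X : (\sum_(m < X) (m < k) = minn X k)%N.
Proof. by elim: X => [|X IH]; rewrite ?big_ord0 ?min0n // big_ord_recr /= IH; lia. Qed.

(** A prime above [z] contributes exactly 1 to the sum of [(sieve_weight / L)^2]. A term
    [b + q * m <= z] forces [m <= z], so the small primes number at most [z.+1]. *)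
Lemma card_prime_progression_le z q b X : (0 < z)%N -> (0 < q)%N ->
  (\sum_(m < X) prime (b + q * m))%:R
  <= X%:R * (q%:R / (totient q)%:R / harm z) + z%:R ^+ 4 + z.+1%:R.
Proof.
move=> z0 q0.
have L1 : 1 <= sieve_mass z q := sieve_mass_ge1 q z0.
have L0 : 0 < sieve_mass z q by apply: lt_le_trans L1.
set L := sieve_mass z q in L0 L1 *.
have h0 : 0 < harm z.
  have h1 : 1 <= harm z.
    have := sieve_mass_ge1 1 z0; congr (1 <= _); apply: eq_bigl => v.
    by rewrite coprimen1 andbT.
  exact: lt_le_trans h1.
have f0 : 0 < ((totient q)%:R : F) by rewrite ltr0n totient_gt0.
have q0' : 0 < (q%:R : F) by rewrite ltr0n.
have LV : L^-1 <= q%:R / (totient q)%:R / harm z.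
  have := sieve_mass_ge z q0; rewrite -/L => H.
  have -> : q%:R / (totient q)%:R / harm z = ((totient q)%:R / q%:R * harm z)^-1.
    by field; rewrite !lt0r_neq0.
  by rewrite lef_pV2 // posrE mulr_gt0 // divr_gt0.
apply: (@le_trans _ _ (\sum_(m < X) ((sieve_weight z q (b + q * m) / L) ^+ 2 + (m < z.+1)%N%:R))).
  rewrite natr_sum; apply: ler_sum => m _.
  have sq : 0 <= (sieve_weight z q (b + q * m) / L) ^+ 2 by exact: sqr_ge0.
  case pr: (prime _); last by rewrite addr_ge0 ?ler0n.
  case: (ltnP z (b + q * m)%N) => zs.
    by rewrite sieve_weight_prime // divff ?lt0r_neq0 // expr1n lerDl ler0n.
  have -> : (m < z.+1)%N.
    by rewrite ltnS; apply: leq_trans zs; apply: leq_trans (leq_addl _ _); rewrite leq_pmull.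
  by rewrite lerDr.
rewrite big_split /=; apply: lerD; last first.
  by rewrite -natr_sum sum_ltn ler_nat geq_minr.
under eq_bigr do rewrite expr_div_n.
rewrite -mulr_suml ler_pdivrMr ?exprn_gt0 //; apply: le_trans (sum_sieve_weight_sqr _ _ _ _) _.
(* Division by [L^2] turns [X * L] into [X / L], and does not increase [z^4] since [L >= 1]. *)
rewrite -/L mulrDl; apply: lerD; last by rewrite ler_peMr ?exprn_ge0 ?ler0n // exprn_ege1.
rewrite -[X in _ <= X]mulrA ler_wpM2l ?ler0n // expr2 mulrA ler_peMl //; first exact: ltW.
by rewrite -ler_pdivrMr // mul1r.
Qed.

End Sieve.


(** * Primes in windows and the theorem *)

(** The [H] points of step 2 are placed among [2H] consecutive integers, then enlarged to whole
    blocks of length [q]; each block has at most one element in the residue class. *)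
Lemma window_progression q r H s0 (A : pred nat) : 0 < q ->
  exists b, \sum_(i < H) (A (s0 + i.*2) && ((s0 + i.*2) %% q == r))
         <= \sum_(m < (H.*2 %/ q).+1) A (b + q * m).
Proof.
move=> q0; pose B s := (A (s0 + s) && ((s0 + s) %% q == r) : nat).
(* As [q - 1] is -1 modulo [q], this is the residue of [r - s0], written without truncated
   subtraction. *)
pose r0 := (r + s0 * q.-1) %% q.
exists (s0 + r0).
apply: (@leq_trans (\sum_(s < (H.*2 %/ q).+1 * q) B s)).
  apply: (@leq_trans (\sum_(s < H * 2) B s)).
    rewrite big_ord_blocks; apply: leq_sum => i _.
    by rewrite !big_ord_recl big_ord0 /= muln2 addn0 leq_addr.
  rewrite (big_ord_widen ((H.*2 %/ q).+1 * q) B); last first.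
    by rewrite muln2 ltnW // -ltn_divLR.
  by rewrite big_mkcond; apply: leq_sum => s _; case: ifP.
rewrite big_ord_blocks; apply: leq_sum => m _.
have r0q : r0 < q by rewrite ltn_pmod.
rewrite (bigD1 (Ordinal r0q)) //= big1 ?addn0 => [|i ir].
  rewrite /B; have -> : s0 + (m * q + r0) = s0 + r0 + q * m by ring.
  by case: (A _) => /=; [exact: leq_b1 |].
apply/eqP; rewrite eqb0; apply: contra ir => /andP[_ /eqP E].
rewrite -val_eqE /= /r0 -E modnDml.
have -> : s0 + (m * q + i) + s0 * q.-1 = (s0 + m) * q + i.
  by rewrite mulnDl -[s0 * q](congr1 (muln s0) (prednK q0)) mulnS; ring.
by rewrite modnMDl modn_small.
Qed.


Section WalkSieve.
Variable F : archiRealFieldType.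
Local Open Scope ring_scope.

Lemma harm_le z : harm F z <= z%:R.
Proof.
rewrite /harm big_mkcond big_ord_recl /= add0r -[X in X%:R]card_ord -sumr_const.
by apply: ler_sum => v _; rewrite invf_le1 ?ltr0n // ler1n.
Qed.

(** Here [l] stands for [log n]. The progression has at most [3H / q] terms, so [l <= 32 * harm F z]
    bounds the main term by [96 H / (phi(q) l)]; the error terms are bounded by the same amount. *)
Lemma card_prime_window_le z q r H s0 (l : F) : (0 < z)%N -> (0 < q)%N ->
  (q ^ 2 <= H)%N -> (z ^ 16 <= H)%N -> 0 < l -> l <= 32 * harm F z ->
  (\sum_(i < H) (prime (s0 + i.*2) && ((s0 + i.*2) %% q == r)))%:R
  <= 192 * H%:R / ((totient q)%:R * l).
Proof.
move=> z0 q0 qH zH l0 lh.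
have [b Hb] := window_progression r H s0 prime q0.
have {}Hb : ((\sum_(i < H) (prime (s0 + i.*2) && ((s0 + i.*2) %% q == r)))%:R : F)
  <= (\sum_(m < (H.*2 %/ q).+1) prime (b + q * m))%:R by rewrite ler_nat.
apply: le_trans Hb _; apply: le_trans (card_prime_progression_le F b _ z0 q0) _.
set f := (totient q)%:R; set h := harm F z in lh *.
have f0 : 0 < f by rewrite ltr0n totient_gt0.
have q0' : 0 < (q%:R : F) by rewrite ltr0n.
have h0 : 0 < h by lra.
have z1 : 1 <= (z%:R : F) by rewrite ler1n.
have fq : f <= q%:R.
  rewrite ler_nat totient_count_coprime big_mkord -[X in (_ <= X)%N]card_ord -sum1_card.
  by apply: leq_sum => d _; exact: leq_b1.
have lz : l <= 32 * z%:R by have := harm_le z; rewrite -/h; lra.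
(* This is what the error needs: it is at most [3 z^4], while [phi(q) l <= 32 q z]. *)
have qz : (q * z ^ 5 <= H)%N.
  rewrite -leq_sqr expnMn -expnM mulnC [X in (_ <= X)%N]expnS expn1 leq_mul //.
  by apply: leq_trans zH; rewrite leq_pexp2l.
have Xq : ((H.*2 %/ q).+1 * q <= 3 * H)%N.
  rewrite mulSn; have := leq_trunc_div H.*2 q; have : (q <= q ^ 2)%N by rewrite leq_pmulr.
  lia.
have Xq' : ((H.*2 %/ q).+1%:R : F) * q%:R <= 3 * H%:R by rewrite -!natrM ler_nat.
have T1 : (H.*2 %/ q).+1%:R * (q%:R / f / h) <= 96 * H%:R / (f * l).
  rewrite mulrA mulrA -[X in X <= _]mulrA -invfM ler_pdivrMr ?mulr_gt0 //.
  apply: le_trans Xq' _.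
  have -> : 96 * H%:R / (f * l) * (f * h) = (3 * H%:R) * (32 * h / l).
    by field; rewrite !lt0r_neq0.
  by rewrite ler_peMr ?mulr_ge0 ?ler0n // ler_pdivlMr // mul1r.
have T2 : z%:R ^+ 4 + z.+1%:R <= 96 * H%:R / (f * l).
  apply: (@le_trans _ _ (3 * z%:R ^+ 4)).
    have z2 : z%:R <= (z%:R : F) ^+ 4 by rewrite -natrX ler_nat -{1}[z]expn1 leq_pexp2l.
    rewrite -[z.+1]addn1 natrD; lra.
  rewrite ler_pdivlMr ?mulr_gt0 //.
  apply: (@le_trans _ _ (3 * z%:R ^+ 4 * (q%:R * (32 * z%:R)))).
    by rewrite ler_wpM2l ?mulr_ge0 ?exprn_ge0 ?ler0n // ler_pM // ltW.
  have -> : 3 * z%:R ^+ 4 * (q%:R * (32 * z%:R)) = 96 * (q * z ^ 5)%N%:R :> F.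
    by rewrite natrM natrX; ring.
  by rewrite ler_wpM2l ?ler0n // ler_nat.
rewrite -addrA; have -> : 192 * H%:R / (f * l) = 96 * H%:R / (f * l) + 96 * H%:R / (f * l) by ring.
exact: lerD.
Qed.

Lemma bin_prime_sum_le z q r H n (l : F) : (0 < z)%N -> (0 < q)%N -> (H ^ 2 <= n)%N ->
  (q ^ 2 <= H)%N -> (z ^ 16 <= H)%N -> 0 < l -> l <= 32 * harm F z ->
  (\sum_(k < n.+1 | (n <= k.*2)%N && (prime (k.*2 - n)%N && ((k.*2 - n) %% q == r)%N)) 'C(n, k))%:R
  <= 384 / ((totient q)%:R * l) * 2 ^+ n.
Proof.
move=> z0 q0 Hn qH zH l0 lh.
have H0 : (0 < H)%N by apply: leq_trans zH; rewrite expn_gt0 z0.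
set f := (totient q)%:R.
have f0 : 0 < f by rewrite ltr0n totient_gt0.
have b0 : 0 <= 192 * H%:R / (f * l) by rewrite divr_ge0 ?mulr_ge0 ?ler0n // ltW.
(* A count of primes is an integer, so the real bound may be replaced by its integer part [M]. *)
have /andP[M1 M2] := Num.Theory.truncn_itv b0; set M := Num.truncn _ in M1 M2.
have := @bin_sum_le n H M (fun s => prime s && (s %% q == r)%N) H0 Hn.
set S := (\sum_(k < _ | _) _)%N => /(_ _) W.
have {}W : (H * S <= M * 2 ^ n.+1)%N.
  apply: W => k; rewrite -ltnS -(ltr_nat F); apply: le_lt_trans M2.
  have := card_prime_window_le r (k.*2 + odd n) z0 q0 qH zH l0 lh.
  by under eq_bigr => i _ do rewrite addnAC -doubleD.
have H0' : 0 < (H%:R : F) by rewrite ltr0n.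
rewrite -(ler_pM2l H0') -natrM.
apply: (@le_trans _ _ (M * 2 ^ n.+1)%N%:R); first by rewrite ler_nat.
rewrite natrM natrX exprS.
apply: le_trans (ler_wpM2r _ M1) _; first by rewrite mulr_ge0 ?exprn_ge0 ?ler0n.
by rewrite le_eqVlt; apply/orP; left; apply/eqP; ring.
Qed.

End WalkSieve.

Lemma root_floor k n : 0 < k -> exists r, r ^ k <= n < r.+1 ^ k.
Proof.
move=> k0; elim: n => [|n [r /andP[r1 r2]]]; first by exists 0; rewrite exp0n // exp1n.
have [H|H] := leqP (r.+1 ^ k) n.+1; last by exists r; rewrite H leqW.
by exists r.+1; rewrite H (leq_ltn_trans r2) // ltn_exp2r.
Qed.

(** A prime position is nonnegative, which gives [n <= 2k] and makes the subtraction exact in [nat];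
    the residue of [a] is nonnegative, so [absz] preserves it. *)
Lemma card_srw_prime n q (a : int) : 0 < q ->
  #|[set x : {ffun 'I_n -> bool} | int_prime (srw x) && int_cong (srw x) a q]|
  = \sum_(k < n.+1 | (n <= k.*2) && (prime (k.*2 - n) && ((k.*2 - n) %% q == absz (modz a q)))) 'C(n, k).
Proof.
move=> q0; rewrite (card_srw n (fun s => int_prime s && int_cong s a q)); apply: eq_bigl => k.
have [nk|kn] := leqP n k.*2; last first.
  by rewrite /int_prime; have -> : (0 <= Posz k.*2 - Posz n)%R = false by lia.
rewrite subzn // /int_prime /int_cong /= modz_nat -eqz_nat gez0_abs //.
by apply: modz_ge0; rewrite -lt0n.
Qed.

(* Real logarithms and the conclusion *)
From Stdlib Require Import Reals Lra.

Lemma ln_monotone (x y : R) : (0 < x <= y -> ln x <= ln y)%R.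
Proof. by case=> x0 [xy|->]; [left; exact: ln_increasing | right]. Qed.

(** Induction on [z]: each step adds [ln (1 + 1/(z+1))] on the left, at most the new term
    [1/(z+1)]. *)
Lemma ln_succ_le_harm z : (ln (INR z.+1) <= harm R z)%R.
Proof.
elim: z => [|z IH].
  by rewrite ln_1 /harm big_mkcond big_ord1 /=; exact: Rle_refl.
have -> : harm R z.+1 = (harm R z + / INR z.+1)%R.
  by rewrite /harm big_mkcond big_ord_recr /= -big_mkcond -INRE RinvE.
have p1 : (0 < INR z.+1)%R by apply: lt_0_INR; lia.
have p2 : (0 < 1 + / INR z.+1)%R by have := Rinv_0_lt_compat _ p1; Lra.lra.
have -> : INR z.+2 = (INR z.+1 * (1 + / INR z.+1))%R.
  by rewrite (S_INR z.+1) Rmult_plus_distr_l Rmult_1_r Rinv_r //; Lra.lra.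
rewrite ln_mult //; apply: Rplus_le_compat => //.
rewrite -[X in (_ <= X)%R]ln_exp; apply: ln_monotone; split=> //; exact: exp_ineq1_le.
Qed.

Lemma INR_le_Rpower_quarter q n (eps : R) : (0 < n)%N -> (0 < eps)%R ->
  (INR q <= Rpower (INR n) (1 / 4 - eps))%R -> (expn q 4 <= n)%N.
Proof.
move=> n0 e0 qn.
have n1 : (1 <= INR n)%R by apply: (le_INR 1); lia.
have q4 : (INR q <= Rpower (INR n) (1 / 4))%R.
  by apply: Rle_trans qn _; apply: Rle_Rpower => //; Lra.lra.
have : (INR q ^ 4 <= INR n)%R.
  apply: Rle_trans (pow_incr _ _ 4 (conj (pos_INR q) q4)) _.
  rewrite -Rpower_pow; last exact: exp_pos.
  rewrite Rpower_mult; have -> : (1 / 4 * INR 4 = 1)%R by rewrite /=; Lra.lra.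
  by rewrite Rpower_1; [exact: Rle_refl | Lra.lra].
by move/RleP; rewrite RpowE !INRE -natrX ler_nat.
Qed.

Theorem theorem1p1 :
  forall eps : R, (0 < eps <= 1 / 4)%R ->
  exists C : R, (0 < C)%R /\
    forall (q : nat) (a : int) (n : nat),
      odd q -> (1 <= q)%N -> coprime (absz a) q -> (2 <= n)%N ->
      (INR q <= Rpower (INR n) (1 / 4 - eps))%R ->
      (walk_prob n (fun s : int => int_prime s && int_cong s a q)
        <= C * (1 / INR (totient q)) * (1 / ln (INR n)))%R.
Proof.
move=> eps [e0 _]; exists 384%R; split; first by Lra.lra.
move=> q a n _ q1 _ n2 qn.
have n0 : (0 < n)%N by lia.
have q4 : (expn q 4 <= n)%N := INR_le_Rpower_quarter n0 e0 qn.
(* [z] and [H] are the integer parts of [n^(1/32)] and [n^(1/2)]; comparing with [n < (H+1)^2]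
   yields [q^2 <= H] and [z^16 <= H]. *)
have [z /andP[zn nz]] := @root_floor 32 n isT.
have [H /andP[Hn nH]] := @root_floor 2 n isT.
have z0 : (0 < z)%N by case: z nz {zn} => // ; rewrite exp1n; lia.
have qH : (expn q 2 <= H)%N.
  by rewrite -ltnS -ltn_sqr; apply: leq_ltn_trans nH; rewrite -expnM.
have zH : (expn z 16 <= H)%N.
  by rewrite -ltnS -ltn_sqr; apply: leq_ltn_trans nH; rewrite -expnM.
have n1 : (1 < INR n)%R by apply: (lt_INR 1); lia.
have l0 : (0 < ln (INR n))%R by rewrite -ln_1; apply: ln_increasing; Lra.lra.
have f0 : (0 < INR (totient q))%R by apply: lt_0_INR; have := totient_gt0 q; lia.
(* The constant 32 is the order of the root: [n < (z+1)^32]. *)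
have lh : (ln (INR n) <= INR 32 * harm R z)%R.
  apply: (@Rle_trans _ (INR 32 * ln (INR z.+1))).
    rewrite -ln_pow; last by apply: lt_0_INR; lia.
    apply: ln_monotone; split; first Lra.lra.
    by apply/RleP; rewrite RpowE !INRE -natrX ler_nat ltnW.
  by apply: Rmult_le_compat_l; [exact: pos_INR | exact: ln_succ_le_harm].
move: lh; rewrite [INR 32]INRE => /RleP lh.
have := bin_prime_sum_le (absz (modz a q)) z0 q1 Hn qH zH (introT RltP l0) lh.
move/RleP; rewrite /walk_prob card_srw_prime //.
set S := (\sum_(k < _ | _) _)%N.
rewrite -!INRE -RpowE -RdivE -!RmultE [INR 384]INR_IZR_INZ [INR 2]INR_IZR_INZ /= => S_le.
have p2 : (0 < 2 ^ n)%R by apply: pow_lt; Lra.lra.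
apply: (Rmult_le_reg_r (2 ^ n)%R) => //.
rewrite /Rdiv Rmult_assoc Rinv_l ?Rmult_1_r; last by Lra.lra.
by apply: Rle_trans S_le _; right; rewrite /Rdiv Rinv_mult !Rmult_1_l !Rmult_assoc.
Qed.
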